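(* Suppose that the divisor $D$ is contained in $\mathrm{Spec}(\mathcal{O}_{C,q})\subseteq C$ and is defined there by $\pi_1^{m_1}\cdots\pi_l^{m_l}$, where the $\pi_i$ are distinct prime elements of $\mathcal{O}_{C,q}$ and all $m_i\ge1$. If for each $i$ the subset $\Sigma_i'\subseteq\mathcal{O}_{C,q}$ induces an $R$-basis of $\mathcal{O}_{C,q}/(\pi_i)$, then $\Sigma_i=\Sigma_i'\cup\pi_i\Sigma_i'\cup\dots\cup\pi_i^{m_i-1}\Sigma_i'$ induces an $R$-basis of $\mathcal{O}_{C,q}/(\pi_i^{m_i})$, $$\Sigma=\Sigma_1\cup\pi_1^{m_1}\Sigma_2\cup\pi_1^{m_1}\pi_2^{m_2}\Sigma_3\cup\dots\cup\pi_1^{m_1}\pi_2^{m_2}\cdots\pi_{l-1}^{m_{l-1}}\Sigma_l$$ induces an $R$-basis of $\mathcal{O}_{C,q}/(\pi_1^{m_1}\cdots\pi_l^{m_l})$, and $\pi_1^{-m_1}\cdots\pi_l^{-m_l}\Sigma$ induces an $R$-basis of $H^0(C,\mathcal{O}_C(D)/\mathcal{O}_C)$. The corresponding statements hold if we replace $\mathcal{O}_{C,q}$ by a ring $B$ with $\mathrm{Spec}(B)\subseteq C$ containing $q$ (and $\pi_i\in B$) if the natural maps $B/(\pi_i)\to\mathcal{O}_{C,q}/(\pi_i)$ are isomorphisms.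
   Context: $R$ is the valuation ring of a finite extension $K$ of $\mathbb{Q}_p$ with residue field $k$, and $C\to\mathrm{Spec}(R)$ is a proper smooth curve with geometrically irreducible fibres, of genus $g$. $D$ is an effective divisor on $C$, finite over $R$, with $\deg(D_k)\ge2g-1$. Each irreducible component of $D$ meets $C_k$ in the same closed point $q$ (so $D$ is contained in $\mathrm{Spec}(\mathcal{O}_{C,q})$); $\mathcal{O}_{C,q}$ is a unique factorisation domain. ''Induces an $R$-basis'' means that the images of the elements form an $R$-basis of the quotient. *)

(* Defs.v *)
From HB Require Import structures.
From mathcomp Require Import all_boot all_order all_algebra all_field.
From mathcomp Require Import boolp classical_sets topology_structure.
From mathcomp Require mpoly.
Import (canonicals, coercions) mpoly.

Set Implicit Arguments.
Unset Strict Implicit.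
Unset Printing Implicit Defensive.

Import Order.TTheory GRing.Theory Num.Theory.
Local Open Scope classical_set_scope.
Local Open Scope ring_scope.

(* The family [v i], [i] in [S], maps to a basis of [M / N]; [sc] is the action
   of [R] on [M], and [N] is meant to be a submodule.  In particular distinct
   indices in [S] have distinct images in the quotient (if [R] is not [0]). *)
Definition is_basis_mod (R : pzRingType) (M : zmodType) (sc : R -> M -> M)
    (N : set M) (I : choiceType) (S : set I) (v : I -> M) : Prop :=
  (forall (s : seq I) (c : I -> R), uniq s -> (forall i, i \in s -> S i) ->
     N (\sum_(i <- s) sc (c i) (v i)) -> forall i, i \in s -> c i = 0) /\
  (forall x : M, exists (s : seq I) (c : I -> R),
     [/\ uniq s, forall i, i \in s -> S i & N (x - \sum_(i <- s) sc (c i) (v i))]).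

Definition has_dim (R : pzRingType) (M : zmodType) (sc : R -> M -> M) (d : nat) :=
  exists e : 'I_d -> M, is_basis_mod sc [set 0] [set: 'I_d] e.

Definition ring_act (R A : pzRingType) (phi : {rmorphism R -> A}) (r : R) (a : A) : A :=
  phi r * a.

Definition divides (A : comPzRingType) (a b : A) : Prop := exists c, b = c * a.

Definition invertible (A : comPzRingType) (a : A) : Prop := exists b, a * b = 1.

Definition induces_basis (R : pzRingType) (A : comPzRingType)
    (phi : {rmorphism R -> A}) (a : A) (S : set A) : Prop :=
  is_basis_mod (ring_act phi) (divides a) S id.

Definition is_prime_elt (A : comPzRingType) (p : A) : Prop :=
  [/\ p <> 0, ~ invertible p &
      forall a b, divides p (a * b) -> divides p a \/ divides p b].

Definition is_irreducible_elt (A : comPzRingType) (p : A) : Prop :=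
  [/\ p <> 0, ~ invertible p &
      forall a b, p = a * b -> invertible a \/ invertible b].

Definition associated (A : comPzRingType) (a b : A) : Prop :=
  exists2 u, invertible u & b = u * a.

Definition is_UFD (A : idomainType) : Prop :=
  (forall a : A, a <> 0 -> ~ invertible a ->
     exists2 s : seq A, (forall x, x \in s -> is_irreducible_elt x)
                      & a = \prod_(x <- s) x) /\
  (forall s t : seq A,
     (forall x, x \in s -> is_irreducible_elt x) ->
     (forall x, x \in t -> is_irreducible_elt x) ->
     associated (\prod_(x <- s) x) (\prod_(x <- t) x) ->
     exists t' : seq A, [/\ perm_eq t t', size s = size t' &
       forall i, (i < size s)%N -> associated s`_i t'`_i]).

Definition is_prime_ideal (A : comPzRingType) (P : set A) : Prop :=
  [/\ P 0, (forall a b, P a -> P b -> P (a + b)), (forall a b, P b -> P (a * b)),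
      ~ P 1 & forall a b, P (a * b) -> P a \/ P b].

(* Additive valuations; the value at [0] is irrelevant. *)
Definition is_valuation (F : fieldType) (v : F -> rat) : Prop :=
  (forall x y, x != 0 -> y != 0 -> v (x * y) = v x + v y) /\
  (forall x y, x != 0 -> y != 0 -> x + y != 0 ->
     Num.min (v x) (v y) <= v (x + y)).

Definition val_ge (F : fieldType) (v : F -> rat) (x : F) (r : rat) : Prop :=
  x = 0 \/ r <= v x.

(* [Qp], valued by [v], is the completion of the rational numbers for the
   [p]-adic valuation. *)
Definition is_padic_numbers (p : nat) (Qp : fieldType) (v : Qp -> rat) : Prop :=
  [/\ is_valuation v,
      forall n : nat, (0 < n)%N -> n%:R != 0 :> Qp /\ v n%:R = (logn p n)%:R,
      forall (x : Qp) (N : nat), exists y : rat, val_ge v (x - ratr y) N%:R &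
      forall u : nat -> Qp,
        (forall N : nat, exists M : nat, forall m n, (M <= m)%N -> (M <= n)%N ->
           val_ge v (u m - u n) N%:R) ->
        exists x, forall N : nat, exists M : nat, forall n, (M <= n)%N ->
           val_ge v (u n - x) N%:R].

Definition is_padic_valuation_ring (R : comNzRingType) : Prop :=
  exists (p : nat) (Qp : fieldType) (v : Qp -> rat) (K : fieldExtType Qp)
         (w : K -> rat) (j : {rmorphism R -> K}),
    [/\ prime p /\ is_padic_numbers p v,
        is_valuation w /\ (forall x : Qp, x != 0 -> w x%:A = v x),
        injective j & forall x : K, (exists r, j r = x) <-> val_ge w x 0].

Definition is_residue_field (R : comNzRingType) (k : fieldType)
    (kappa : {rmorphism R -> k}) : Prop :=
  (forall y, exists r, kappa r = y) /\
  (forall r, kappa r = 0 <-> ~ invertible r).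

Identity Coercion set_to_fun : set >-> Funclass.

Record opens (X : topologicalType) :=
  Opens { opset :> set X; opens_open : open opset }.

Definition opT (X : topologicalType) : opens X := Opens (@openT X).
Definition opI (X : topologicalType) (U V : opens X) : opens X :=
  Opens (openI (opens_open U) (opens_open V)).
Arguments opT {X}.

Definition is_sheaf (X : topologicalType) (F : opens X -> Type)
    (res : forall U V : opens X, V `<=` U -> F U -> F V) : Prop :=
  [/\ forall (U : opens X) (h : U `<=` U) s, res U U h s = s,
      forall (U V W : opens X) (h1 : V `<=` U) (h2 : W `<=` V) (h3 : W `<=` U) s,
        res V W h2 (res U V h1 s) = res U W h3 s,
      forall (U : opens X) (s t : F U),
        (forall x, U x -> exists (V : opens X) (h : V `<=` U),
           V x /\ res U V h s = res U V h t) -> s = t &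
      forall (U : opens X) (I : Type) (V : I -> opens X) (h : forall i, V i `<=` U)
             (s : forall i, F (V i)),
        (forall x, U x -> exists i, V i x) ->
        (forall i j (W : opens X) (hi : W `<=` V i) (hj : W `<=` V j),
           res (V i) W hi (s i) = res (V j) W hj (s j)) ->
        exists t : F U, forall i, res U (V i) (h i) t = s i].

Record ringed_space := RingedSpace {
  space :> topologicalType;
  sec : opens space -> comPzRingType;
  res : forall U V : opens space, V `<=` U -> {rmorphism sec U -> sec V};
  res_sheaf : is_sheaf (fun U V h => res h : sec U -> sec V)
}.


Definition unit_at (X : ringed_space) (U : opens X) (x : X) (s : sec U) : Prop :=
  exists (V : opens X) (h : V `<=` U), V x /\ invertible (res h s).

(* The stalks are local rings. *)
Definition is_locally_ringed (X : ringed_space) : Prop :=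
  forall (U : opens X) (x : X), U x ->
    ~ unit_at x (0 : sec U) /\
    forall s t : sec U, unit_at x (s + t) -> unit_at x s \/ unit_at x t.

(* [A], with the given germ maps, is the colimit of the [sec U], [U] an open
   neighbourhood of [x]. *)
Record stalk (X : ringed_space) (x : X) (A : comPzRingType) := Stalk {
  germ : forall U : opens X, U x -> {rmorphism sec U -> A};
  germ_res : forall (U V : opens X) (h : V `<=` U) (hU : U x) (hV : V x) (s : sec U),
    germ hV (res h s) = germ hU s;
  germ_surj : forall a : A, exists (U : opens X) (hU : U x) (s : sec U),
    germ hU s = a;
  germ_inj : forall (U : opens X) (hU : U x) (s : sec U), germ hU s = 0 ->
    exists (V : opens X) (h : V `<=` U), V x /\ res h s = 0
}.
Arguments germ {X x A} s {U} : rename.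


(* The canonical morphism from [U] to [Spec (sec U)], which maps [x] to the prime
   ideal of the sections that are not invertible at [x], is an isomorphism. *)
Definition is_affine (X : ringed_space) (U : opens X) : Prop :=
  [/\ forall P : set (sec U), is_prime_ideal P ->
        exists! x, U x /\ (forall s, P s <-> ~ unit_at x s),
      forall (V : opens X) x, V `<=` U -> V x ->
        exists s : sec U, unit_at x s /\ (forall y, U y -> unit_at y s -> V y) &
      forall (s : sec U) (W : opens X) (h : W `<=` U),
        (forall y, W y <-> U y /\ unit_at y s) ->
        (forall t : sec W, exists (n : nat) (a : sec U),
           res h a = t * res h s ^+ n) /\
        (forall a : sec U, res h a = 0 -> exists n : nat, s ^+ n * a = 0)].

Record scheme := Scheme {
  lrs :> ringed_space;
  scheme_local : is_locally_ringed lrs;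
  scheme_affine : forall x : lrs, exists U : opens lrs, U x /\ is_affine U
}.

Record morphism (X Y : scheme) := Morphism {
  mor :> X -> Y;
  mor_cont : forall U : opens Y, open (mor @^-1` U);
  pull : forall (U : opens Y) (V : opens X), V `<=` mor @^-1` U ->
    {rmorphism sec U -> sec V};
  pull_res : forall (U U' : opens Y) (V V' : opens X)
    (h : V `<=` mor @^-1` U) (h' : V' `<=` mor @^-1` U')
    (hU : U' `<=` U) (hV : V' `<=` V) (s : sec U),
    pull h' (res hU s) = res hV (pull h s);
  mor_local : forall (U : opens Y) (V : opens X) (h : V `<=` mor @^-1` U) x (s : sec U),
    V x -> unit_at x (pull h s) -> unit_at (mor x) s
}.
Arguments pull {X Y} m {U V} : rename.


Definition mor_eq (X Y : scheme) (f g : morphism X Y) : Prop :=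
  (forall x, f x = g x) /\
  (forall (U : opens Y) (V : opens X) (h : V `<=` f @^-1` U) (h' : V `<=` g @^-1` U)
     (s : sec U), pull f h s = pull g h' s).

(* [h] is the composition of [f] followed by [g]. *)
Definition is_comp (X Y Z : scheme) (g : morphism Y Z) (f : morphism X Y)
    (h : morphism X Z) : Prop :=
  (forall x, h x = g (f x)) /\
  (forall (U : opens Z) (V : opens Y) (W : opens X) (hg : V `<=` g @^-1` U)
     (hf : W `<=` f @^-1` V) (hh : W `<=` h @^-1` U) (s : sec U),
     pull h hh s = pull f hf (pull g hg s)).

Definition is_id (X : scheme) (f : morphism X X) : Prop :=
  (forall x, f x = x) /\
  (forall (U V : opens X) (h : V `<=` f @^-1` U) (h' : V `<=` U) (s : sec U),
     pull f h s = res h' s).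

Definition pull_global (X Y : scheme) (f : morphism X Y) :
    {rmorphism @sec Y opT -> @sec X opT} :=
  pull f (U := opT) (V := opT) (fun _ _ => Logic.I).

(* A scheme over [Spec R]: morphisms from [X] to [Spec R] are the ring homomorphisms
   from [R] to the ring of global sections of [X]. *)
Record scheme_over (R : comPzRingType) := SchemeOver {
  total :> scheme;
  str : {rmorphism R -> @sec total opT}
}.
Arguments str {R} s.

(* [f : Y -> X] lies over [Spec R' -> Spec R]. *)
Definition is_over (R R' : comPzRingType) (phi : {rmorphism R -> R'})
    (X : scheme_over R) (Y : scheme_over R') (f : morphism Y X) : Prop :=
  forall r, pull_global f (str X r) = str Y (phi r).

Definition is_over_id (R : comPzRingType) (X Y : scheme_over R) (f : morphism Y X) :=
  is_over (idfun : {rmorphism R -> R}) f.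

Definition is_base_change (R R' : comPzRingType) (phi : {rmorphism R -> R'})
    (X : scheme_over R) (X' : scheme_over R') (pr : morphism X' X) : Prop :=
  is_over phi pr /\
  forall (T : scheme_over R') (t : morphism T X), is_over phi t ->
    exists u : morphism T X', [/\ is_over_id u, is_comp pr u t &
      forall u' : morphism T X', is_over_id u' -> is_comp pr u' t -> mor_eq u u'].

Definition is_fibre_product (R : comPzRingType) (X Y P : scheme_over R)
    (p1 : morphism P X) (p2 : morphism P Y) : Prop :=
  [/\ is_over_id p1, is_over_id p2 &
    forall (T : scheme_over R) (t1 : morphism T X) (t2 : morphism T Y),
      is_over_id t1 -> is_over_id t2 ->
      exists u : morphism T P, [/\ is_over_id u, is_comp p1 u t1, is_comp p2 u t2 &
        forall u' : morphism T P, is_over_id u' -> is_comp p1 u' t1 ->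
          is_comp p2 u' t2 -> mor_eq u u']].

(* A homeomorphism onto a closed subset, surjective on stalks. *)
Definition is_closed_immersion (X Y : scheme) (i : morphism X Y) : Prop :=
  [/\ injective i, forall Z : set X, closed Z -> closed (i @` Z) &
      forall (V : opens X) (x : X) (s : sec V), V x ->
        exists (U : opens Y) (W : opens X) (hi : W `<=` i @^-1` U) (h : W `<=` V)
               (t : sec U), W x /\ pull i hi t = res h s].

Definition is_separated (R : comPzRingType) (X : scheme_over R) : Prop :=
  forall (P : scheme_over R) (p1 p2 : morphism P X) (delta : morphism X P)
         (e1 e2 : morphism X X),
    is_fibre_product p1 p2 -> is_over_id delta -> is_id e1 -> is_id e2 ->
    is_comp p1 delta e1 -> is_comp p2 delta e2 -> is_closed_immersion delta.

Definition is_fg_algebra (R A : comPzRingType) (phi : {rmorphism R -> A}) : Prop :=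
  exists (n : nat) (b : 'I_n -> A), forall S : set A,
    (forall r, S (phi r)) -> (forall i, S (b i)) ->
    (forall x y, S x -> S y -> S (x + y)) -> (forall x y, S x -> S y -> S (x * y)) ->
    forall x, S x.

Definition str_on (R : comPzRingType) (X : scheme_over R) (U : opens X) :
    {rmorphism R -> sec U} :=
  res (U := opT) (V := U) (fun _ _ => Logic.I) \o str X.

Definition is_finite_type (R : comPzRingType) (X : scheme_over R) : Prop :=
  exists (n : nat) (U : 'I_n -> opens X),
    (forall x, exists i, U i x) /\
    (forall i, is_affine (U i) /\ is_fg_algebra (str_on (U i))).

(* For every ring homomorphism [R -> R'], the map from the base change [X'] to
   [Spec R'] is closed; the closed subsets of [Spec R'] are the sets of primes
   containing a given subset. *)
Definition is_universally_closed (R : comPzRingType) (X : scheme_over R) : Prop :=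
  forall (R' : comPzRingType) (phi : {rmorphism R -> R'}) (X' : scheme_over R')
         (pr : morphism X' X), is_base_change phi pr ->
  forall Z : set X', closed Z ->
    exists J : set R', forall P : set R', is_prime_ideal P ->
      ((exists2 x, Z x & forall r, P r <-> ~ unit_at x (str X' r)) <-> J `<=` P).

Definition is_proper (R : comPzRingType) (X : scheme_over R) : Prop :=
  [/\ is_separated X, is_finite_type X & is_universally_closed X].

Definition eval_mpoly (R : comNzRingType) (A : comPzRingType) (phi : {rmorphism R -> A})
    (n : nat) (b : 'I_n -> A) (f : mpoly.mpoly n R) : A :=
  \sum_(m <- mpoly.msupp f) phi (mpoly.mcoeff m f) * \prod_(i < n) b i ^+ mpoly.fun_of_multinom m i.

(* [A] is isomorphic to [R[x_1, ..., x_(c+d)] / (f_1, ..., f_c)], the minor of the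
   Jacobian matrix belonging to [x_1, ..., x_c] being invertible in [A]. *)
Definition is_standard_smooth (R : comNzRingType) (A : comPzRingType)
    (phi : {rmorphism R -> A}) (d : nat) : Prop :=
  exists (c : nat) (b : 'I_(c + d) -> A) (f : 'I_c -> mpoly.mpoly (c + d) R),
    [/\ forall a, exists g, eval_mpoly phi b g = a,
        forall g, eval_mpoly phi b g = 0 <->
          exists h : 'I_c -> mpoly.mpoly (c + d) R, g = \sum_(j < c) h j * f j &
        invertible (eval_mpoly phi b
          (\det (\matrix_(i < c, j < c) mpoly.mderiv (lshift d i) (f j))))].

Definition is_smooth_of_rel_dim (R : comNzRingType) (X : scheme_over R) (d : nat) :=
  forall x : X, exists U : opens X,
    [/\ U x, is_affine U & is_standard_smooth (str_on U) d].

Definition is_irreducible_set (X : topologicalType) (Z : set X) : Prop :=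
  Z !=set0 /\ forall U V : set X, open U -> open V ->
    (Z `&` U) !=set0 -> (Z `&` V) !=set0 -> (Z `&` (U `&` V)) !=set0.

Definition is_irreducible_component (X : topologicalType) (Z : set X) : Prop :=
  is_irreducible_set Z /\
  forall Z' : set X, is_irreducible_set Z' -> Z `<=` Z' -> Z' `<=` Z.

(* A homomorphism from [R] to a field [L] is a point of [Spec R] together with an
   extension [L] of its residue field. *)
Definition has_geom_irreducible_fibres (R : comPzRingType) (X : scheme_over R) :=
  forall (L : fieldType) (phi : {rmorphism R -> L}) (X' : scheme_over L)
         (pr : morphism X' X),
    is_base_change phi pr -> is_irreducible_set [set: X'].

Definition cochain (X : ringed_space) (n : nat) (U : 'I_n -> opens X) :=
  forall i j, sec (opI (U i) (U j)).

Definition is_cocycle (X : ringed_space) (n : nat) (U : 'I_n -> opens X)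
    (c : cochain U) : Prop :=
  forall i j l (W : opens X) (hij : W `<=` opI (U i) (U j))
    (hjl : W `<=` opI (U j) (U l)) (hil : W `<=` opI (U i) (U l)),
    res hil (c i l) = res hij (c i j) + res hjl (c j l).

Definition is_coboundary (X : ringed_space) (n : nat) (U : 'I_n -> opens X)
    (c : cochain U) : Prop :=
  exists b : forall i, sec (U i),
    forall i j (hi : opI (U i) (U j) `<=` U i) (hj : opI (U i) (U j) `<=` U j),
      c i j = res hj (b j) - res hi (b i).

(* The first cohomology of the structure sheaf of [X], computed as Cech cohomology
   of a finite affine open cover, has dimension [g]. *)
Definition has_genus (L : fieldType) (X : scheme_over L) (g : nat) : Prop :=
  exists (n : nat) (U : 'I_n -> opens X),
    [/\ forall x, exists i, U i x, forall i, is_affine (U i) &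
    exists e : 'I_g -> cochain U,
      let comb (a : 'I_g -> L) : cochain U :=
        fun i j => \sum_(t < g) str_on (opI (U i) (U j)) (a t) * e t i j in
      [/\ forall t, is_cocycle (e t),
          forall a, is_coboundary (comb a) -> forall t, a t = 0 &
          forall c : cochain U, is_cocycle c ->
            exists a, is_coboundary (fun i j => c i j - comb a i j)]].

Definition has_fibres_of_genus (R : comPzRingType) (X : scheme_over R) (g : nat) :=
  forall (L : fieldType) (phi : {rmorphism R -> L}) (X' : scheme_over L)
         (pr : morphism X' X), is_base_change phi pr -> has_genus X' g.

Record is_proper_smooth_curve (R : comNzRingType) (C : scheme_over R) (g : nat) : Prop := {
  curve_proper : is_proper C;
  curve_smooth : is_smooth_of_rel_dim C 1;
  curve_geom_irreducible : has_geom_irreducible_fibres C;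
  curve_genus : has_fibres_of_genus C g
}.

(* The ideal sheaf of the closed subscheme [i : D -> C]. *)
Definition ideal_sec (C D : scheme) (i : morphism D C) (U : opens C) : set (sec U) :=
  fun s => forall (V : opens D) (h : V `<=` i @^-1` U), pull i h s = 0.

(* [d] generates the ideal sheaf of [D] on [U] and is a non-zero-divisor, both on all
   open subsets of [U]. *)
Definition is_local_equation (C D : scheme) (i : morphism D C) (U : opens C)
    (d : sec U) : Prop :=
  forall (V : opens C) (h : V `<=` U),
    (forall s : sec V, ideal_sec i s <-> divides (res h d) s) /\
    (forall s : sec V, s * res h d = 0 -> s = 0).

Definition is_effective_divisor (C D : scheme) (i : morphism D C) : Prop :=
  is_closed_immersion i /\
  forall x : C, exists (U : opens C) (d : sec U), U x /\ is_local_equation i d.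

Definition is_finite_over (R : comPzRingType) (X : scheme_over R) : Prop :=
  @is_affine X opT /\
  exists (n : nat) (b : 'I_n -> @sec X opT), forall x,
    exists c : 'I_n -> R, x = \sum_(i < n) str X (c i) * b i.

(* [i : D -> C] has degree [d] over the point of [Spec R] given by [phi : R -> k]. *)
Definition has_degree_at (R : comPzRingType) (D : scheme_over R) (k : fieldType)
    (phi : {rmorphism R -> k}) (d : nat) : Prop :=
  exists (Dk : scheme_over k) (pr : morphism Dk D),
    is_base_change phi pr /\ has_dim (ring_act (str Dk)) d.

(* The points of the fibre over the point of [Spec R] given by [phi : R -> k]. *)
Definition fibre_points (R : comPzRingType) (C : scheme_over R) (k : fieldType)
    (phi : {rmorphism R -> k}) : set C :=
  fun x => forall r, phi r = 0 <-> ~ unit_at x (str C r).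

(* The image of the spectrum of the local ring at [q]. *)
Definition local_spec (X : topologicalType) (q : X) : set X :=
  fun x => forall U : opens X, U q -> U x.

Definition is_generic_point (X : topologicalType) (eta : X) : Prop :=
  forall U : opens X, U !=set0 -> U eta.

Definition ideal_stalk (C D : scheme) (i : morphism D C) (q : C) (A : comPzRingType)
    (stA : stalk q A) : set A :=
  fun a => exists (U : opens C) (hU : U q) (s : sec U),
    ideal_sec i s /\ germ stA hU s = a.

(* [F] is the function field of [C], the stalk at the generic point [eta]; sections
   of [O_C] and [O_C(D)] over [U] are elements of [F].  On the empty set the two
   predicates below hold for all elements of [F]. *)
Definition sheaf_O (C : scheme) (eta : C) (F : comPzRingType)
    (stF : stalk eta F) (U : opens C) : set F :=
  fun f => forall x, U x ->
    exists (V : opens C) (hV : V eta) (a : sec V),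
      [/\ V x, V `<=` U & f = germ stF hV a].

Definition sheaf_OD (C D : scheme) (i : morphism D C) (eta : C) (F : comPzRingType)
    (stF : stalk eta F) (U : opens C) : set F :=
  fun f => forall x, U x ->
    exists (V : opens C) (hV : V eta) (d a : sec V),
      [/\ V x, V `<=` U, is_local_equation i d & germ stF hV d * f = germ stF hV a].

Record module_sheaf (R : pzRingType) (X : topologicalType) := ModuleSheaf {
  msec : opens X -> lmodType R;
  mres : forall U V : opens X, V `<=` U -> {linear msec U -> msec V};
  mres_sheaf : is_sheaf (fun U V h => mres h : msec U -> msec V)
}.
Arguments mres {R X} m {U V} : rename.


(* [Q] is the quotient sheaf [E / E0] of sheaves of [R]-submodules of [F], by means
   of the projections [pi]: these are [R]-linear, compatible with restrictions, have
   kernel [E0] and are locally surjective.  The values of [pi U] outside of [E U] are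
   irrelevant. *)
Definition is_quotient_sheaf (R : pzRingType) (X : topologicalType) (F : zmodType)
    (sc : R -> F -> F) (E E0 : opens X -> set F) (Q : module_sheaf R X)
    (pi : forall U : opens X, F -> msec Q U) : Prop :=
  [/\ forall (U : opens X) r f g, E U f -> E U g ->
        pi U (sc r f + g) = r *: pi U f + pi U g,
      forall (U V : opens X) (h : V `<=` U) f, E U f -> mres Q h (pi U f) = pi V f,
      forall (U : opens X) f, E U f -> (pi U f = 0 <-> E0 U f) &
      forall (U : opens X) (s : msec Q U) x, U x ->
        exists (V : opens X) (h : V `<=` U) (f : F),
          [/\ V x, E V f & mres Q h s = pi V f]].

(* The global section [s] of [Q = E / E0] is induced by [f] at [q]: its germ at [q]
   is the class of [f]. *)
Definition is_induced_at (R : pzRingType) (X : topologicalType) (F : zmodType)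
    (E : opens X -> set F) (Q : module_sheaf R X) (pi : forall U : opens X, F -> msec Q U)
    (q : X) (f : F) (s : msec Q opT) : Prop :=
  exists (U : opens X) (h : U `<=` opT), [/\ U q, E U f & mres Q h s = pi U f].

(* The subset [S] of the stalk of [E] at [q] induces an [R]-basis of [H^0(X, Q)]:
   every element of [S] induces exactly one global section of [Q], and these
   sections form a basis. *)
Definition induces_basis_H0 (R : pzRingType) (X : topologicalType) (F : fieldType)
    (E : opens X -> set F) (Q : module_sheaf R X) (pi : forall U : opens X, F -> msec Q U)
    (q : X) (S : set F) : Prop :=
  exists h : F -> msec Q opT,
    (forall f, S f -> forall s, is_induced_at E pi q f s <-> s = h f) /\
    is_basis_mod (fun r s => r *: s) [set 0] S h.

(* [j : S -> C] identifies the scheme [S] with a subset of [C] with the induced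
   topology and the same local rings, such as an open subscheme or the spectrum of
   a local ring of [C]. *)
Definition is_subspace_with_stalks (S C : scheme) (j : morphism S C) : Prop :=
  [/\ injective j,
      forall (V : opens S) y, V y ->
        exists U : opens C, U (j y) /\ (forall z, U (j z) -> V z),
      forall (U : opens C) (V : opens S) (h : V `<=` j @^-1` U) y (s : sec U), V y ->
        pull j h s = 0 -> exists (U' : opens C) (h' : U' `<=` U), U' (j y) /\ res h' s = 0 &
      forall (V : opens S) y (t : sec V), V y ->
        exists (U : opens C) (V' : opens S) (hj : V' `<=` j @^-1` U) (h : V' `<=` V)
               (s : sec U), V' y /\ pull j hj s = res h t].

(* [beta] is the natural map from the ring of global sections of [S] to the local
   ring [A] of [C] at [q = j y]. *)
Definition is_natural_to_stalk (S C : scheme) (j : morphism S C) (y : S) (q : C)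
    (A : comPzRingType) (stA : stalk q A)
    (beta : {rmorphism @sec S opT -> A}) : Prop :=
  forall (b : @sec S opT) (U : opens C) (hU : U q) (s : sec U) (V : opens S)
         (hj : V `<=` j @^-1` U) (h : V `<=` opT),
    V y -> pull j hj s = res h b -> beta b = germ stA hU s.

Definition iso_mod (A B : comPzRingType) (beta : {rmorphism B -> A}) (b : B) : Prop :=
  (forall x, divides (beta b) (beta x) -> divides b x) /\
  (forall a, exists x, divides (beta b) (a - beta x)).

Definition power_union (A : comPzRingType) (p : A) (m : nat) (S : set A) : set A :=
  [set y | exists j x, [/\ (j < m)%N, S x & y = p ^+ j * x]].

Definition twisted_union (A : comPzRingType) (l : nat) (p : 'I_l -> A) (m : 'I_l -> nat)
    (S : 'I_l -> set A) : set A :=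
  [set y | exists i x, S i x /\ y = (\prod_(j < l | (j < i)%N) p j ^+ m j) * x].

Definition total_product (A : comPzRingType) (l : nat) (p : 'I_l -> A) (m : 'I_l -> nat) : A :=
  \prod_(i < l) p i ^+ m i.

(* Main.v *)
Require Import Defs.
From HB Require Import structures.
From mathcomp Require Import all_boot all_order all_algebra all_field.
From mathcomp Require Import boolp classical_sets topology_structure.

Set Implicit Arguments.
Unset Strict Implicit.
Unset Printing Implicit Defensive.

Import Order.TTheory GRing.Theory Num.Theory.
Local Open Scope classical_set_scope.
Local Open Scope ring_scope.

(* If [S] induces a basis modulo [b1] and [T] one modulo [b2], with [b1] regular, then
   the union of [S] and [b1 T] induces a basis modulo [b1 b2]; iterating this gives
   the first two claims.

   As [D] lies in the spectrum of the local ring at [q], every neighbourhood of [q]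
   contains [D].  The quotient O(D)/O vanishes off [D], so a global section of it is
   the same thing as a germ at [q], that is, as an element of P^-1 A / A, where the
   generator [P] of the stalk of the ideal of [D] is the product of the prime powers.
   Multiplication by [P] identifies this module with A / P A. *)

(** * Bases of quotient rings modulo a product *)

(** [is_basis_mod] asks for a duplicate-free list of indices, while combinations built by
    concatenation or mapping may repeat an index. The coefficients of equal indices are added up. *)
Lemma combination_collect (R : pzRingType) (M : zmodType) (sc : R -> M -> M)
    (sc0 : forall w, sc 0 w = 0)
    (scD : forall w, {morph sc^~ w : a b / a + b >-> a + b})
    (I : choiceType) (S : set I) (v : I -> M) (L : seq (R * I)) :
  (forall u, u \in L -> S u.2) ->
  exists (s : seq I) (c : I -> R),
    [/\ uniq s, forall i, i \in s -> S i &
        \sum_(u <- L) sc u.1 (v u.2) = \sum_(i <- s) sc (c i) (v i)].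
Proof.
move=> LS; exists (undup [seq u.2 | u <- L]).
exists (fun i => \sum_(u <- L | u.2 == i) u.1); split.
- exact: undup_uniq.
- by move=> i; rewrite mem_undup => /mapP [u /LS Su ->].
have -> : \sum_(i <- undup [seq u.2 | u <- L])
              sc (\sum_(u <- L | u.2 == i) u.1) (v i) =
          \sum_(i <- undup [seq u.2 | u <- L])
              \sum_(u <- L | u.2 == i) sc u.1 (v u.2).
  apply: eq_bigr => i _; rewrite (big_morph (sc^~ (v i)) (scD _) (sc0 _)).
  by apply: eq_bigr => u /eqP ->.
rewrite (exchange_big_dep xpredT) //= [LHS]big_seq [RHS]big_seq.
apply: eq_bigr => u uL.
rewrite -big_filter (eq_filter (a2 := pred1 u.2)); last by move=> i; rewrite /= eq_sym.
by rewrite filter_pred1_uniq ?undup_uniq ?big_seq1 // mem_undup map_f.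
Qed.

Section Algebra.
Variables (R B : comPzRingType) (phi : {rmorphism R -> B}).

Lemma ring_act0 w : ring_act phi 0 w = 0.
Proof. by rewrite /ring_act rmorph0 mul0r. Qed.

Lemma ring_actD w : {morph (ring_act phi)^~ w : a b / a + b >-> a + b}.
Proof. by move=> a b; rewrite /ring_act rmorphD mulrDl. Qed.

Lemma divides1 (b : B) : divides 1 b.
Proof. by exists b; rewrite mulr1. Qed.

Lemma dividesD (b x y : B) : divides b x -> divides b y -> divides b (x + y).
Proof. by move=> [c ->] [d ->]; exists (c + d); rewrite mulrDl. Qed.

Lemma induces_basis_unit : induces_basis phi 1 set0.
Proof.
split=> [s c _ sS _ i /sS //|x].
by exists [::], (fun=> 0); split => //; apply: divides1.
Qed.

End Algebra.

(* [B] is not known to be a domain: cancellation takes place in [A], and [iso_mod]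
   brings the result back to [B].  The case of [A] itself is [beta = idfun]. *)
Section BaseRing.
Variables (R B : comPzRingType) (A : idomainType).
Variables (phi : {rmorphism R -> B}) (beta : {rmorphism B -> A}).

Lemma iso_mod1 : iso_mod beta 1.
Proof.
split=> [x _|a]; first exact: divides1.
by exists 0; rewrite rmorph1; apply: divides1.
Qed.

(** Injectivity: divide by [b1], cancel [beta b1] in the domain [A], then divide by [b2].
    Surjectivity: approximate [a] modulo [b1], then approximate the quotient of the error modulo
    [b2]. *)
Lemma iso_modM b1 b2 : beta b1 != 0 ->
  iso_mod beta b1 -> iso_mod beta b2 -> iso_mod beta (b1 * b2).
Proof.
move=> n1 [i1 s1] [i2 s2]; split=> [x [c]|a].
  rewrite rmorphM => ec.
  have [y ey] : divides b1 x.
    by apply: i1; exists (c * beta b2); rewrite ec mulrCA mulrC.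
  have [z ez] : divides b2 y.
    apply: i2; exists c; apply: (mulfI n1).
    by rewrite mulrC -rmorphM -ey ec mulrCA.
  by exists z; rewrite ey ez -mulrA [b2 * b1]mulrC.
have [x [c ec]] := s1 a; have [y [e ee]] := s2 c.
exists (x + b1 * y), e; rewrite rmorphD !rmorphM opprD addrA ec.
by rewrite [beta b1 * beta y]mulrC -mulrBl ee -mulrA [beta b2 * _]mulrC.
Qed.

Lemma iso_mod_exp b n : beta b != 0 -> iso_mod beta b -> iso_mod beta (b ^+ n).
Proof.
move=> b0 ib; elim: n => [|n IHn]; first exact: iso_mod1.
by rewrite exprS; apply: iso_modM.
Qed.

(** This is the extension of [B/(b1)] by [B/(b2)], the latter embedded in [B/(b1 * b2)] through
    multiplication by [b1]. For spanning, expand [x] modulo [b1] and then the quotient of the error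
    modulo [b2]. For independence, reduce modulo [b1] first. *)
Lemma induces_basisM b1 b2 (S T : set B) :
  beta b1 != 0 -> iso_mod beta b2 ->
  induces_basis phi b1 S -> induces_basis phi b2 T ->
  induces_basis phi (b1 * b2) (S `|` [set b1 * t | t in T]).
Proof.
move=> n1 [i2 _] [indS spanS] [indT spanT]; split; last first.
  move=> x; have [s [c [_ sS [y ey]]]] := spanS x.
  have [t [e [_ tT [z ez]]]] := spanT y.
  pose L := [seq (c i, i) | i <- s] ++ [seq (e i, b1 * i) | i <- t].
  have LST u : u \in L -> (S `|` [set b1 * t | t in T]) u.2.
    rewrite mem_cat => /orP[] /mapP[i hi ->]; first by left; apply: sS.
    by right; exists i => //; apply: tT.
  have [r [f [ur rS er]]] := combination_collect (ring_act0 phi) (ring_actD phi) id LST.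
  exists r, f; split=> //; rewrite -er big_cat !big_map /= opprD addrA ey.
  exists z; rewrite [b1 * b2]mulrC mulrA -ez mulrBl; congr (_ - _).
  by rewrite mulr_suml; apply: eq_bigr => i _; rewrite /ring_act /= mulrCA mulrC.
move=> s c us sST [w].
(* [tau] divides by [b1] the indices of [s] outside [S]; elsewhere its value 0 is arbitrary. *)
have /choice [tau tauP] : forall i, exists t, i \in s -> ~ S i -> T t /\ b1 * t = i.
  move=> i; have [si|si] := boolP (i \in s); last by exists 0.
  by case: (sST _ si) => [Si|[t Tt ti]]; [exists 0|exists t].
pose r := [seq i <- s | ~~ `[< S i >]].
have rP i : i \in r -> T (tau i) /\ b1 * tau i = i.
  by rewrite mem_filter => /andP[/asboolPn nS si]; apply: tauP.
pose Z := \sum_(i <- r) ring_act phi (c i) (tau i).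
rewrite (bigID (fun i => `[< S i >])) /= -big_filter -[X in _ + X]big_filter -/r.
have -> : \sum_(i <- r) ring_act phi (c i) i = Z * b1.
  rewrite mulr_suml !big_seq; apply: eq_bigr => i /rP [_ ti].
  by rewrite /ring_act -mulrA [_ * b1]mulrC ti.
move=> ew.
(* Modulo [b1] the terms outside [S] vanish, which leaves a relation among elements of [S] alone. *)
have cS i : i \in s -> S i -> c i = 0.
  move=> si Si.
  apply: (indS [seq i <- s | `[< S i >]] c); first exact: filter_uniq.
  - by move=> j; rewrite mem_filter => /andP[/asboolP].
  - exists (w * b2 - Z); rewrite mulrBl; apply/eqP; rewrite eq_sym subr_eq eq_sym.
    by rewrite ew mulrAC -mulrA.
  - by rewrite mem_filter si andbT; apply/asboolP.
move=> i si; have [/(cS _ si) //|nSi] := pselect (S i).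
have tauK : {in r, cancel tau ( *%R b1)} by move=> a /rP[].
rewrite -(tauK i); last by rewrite mem_filter si andbT; apply/asboolPn.
apply: (indT [seq tau i | i <- r] (fun t => c (b1 * t))).
- rewrite map_inj_in_uniq ?filter_uniq //; exact: can_in_inj tauK.
- by move=> a /mapP[a' /rP[] ? _ ->].
(* With the terms in [S] gone, [Z * b1] is [w * (b1 * b2)]. The factor [b1] is cancelled after
   applying [beta], and [i2] returns the divisibility of [Z] by [b2] to [B]. *)
- have [|v ev] := i2 Z; last first.
  + exists v; rewrite -ev /Z big_map !big_seq; apply: eq_bigr => a ar /=.
    by rewrite (tauK a).
  + exists (beta w); apply: (mulfI n1); move: ew; rewrite big_filter big_seq_cond.
    rewrite big1 ?add0r => [ew|a /andP[sa /asboolP Sa]]; last first.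
      by rewrite cS // ring_act0.
    by rewrite mulrC -rmorphM ew !rmorphM mulrCA.
- by apply: map_f; rewrite mem_filter si andbT; apply/asboolPn.
Qed.

(** Each step appends the layer of the multiples of [S] by [b ^+ m]. Factoring [b ^+ m.+1] as
    [b ^+ m * b] puts the isomorphism hypothesis on [b] itself. *)
Lemma induces_basis_power b m (S : set B) : beta b != 0 -> iso_mod beta b ->
  induces_basis phi b S -> induces_basis phi (b ^+ m) (power_union b m S).
Proof.
move=> b0 ib bS; elim: m => [|m IHm].
  have -> : power_union b 0 S = set0 by rewrite -subset0 => x [j [y []]].
  exact: induces_basis_unit.
have -> : power_union b m.+1 S = power_union b m S `|` [set b ^+ m * x | x in S].
  apply/seteqP; split=> x.
    move=> [j [y [+ Sy ->]]]; rewrite ltnS leq_eqVlt => /orP[/eqP ->|jm].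
      by right; exists y.
    by left; exists j, y.
  move=> [[j [y [jm Sy ->]]]|[y Sy <-]]; last by exists m, y.
  by exists j, y; split=> //; apply: ltnW.
by rewrite exprSr; apply: induces_basisM; rewrite ?rmorphXn ?expf_neq0.
Qed.

Lemma iso_mod_prod l (b : 'I_l -> B) (P : pred 'I_l) :
  (forall n, beta (b n) != 0) -> (forall n, iso_mod beta (b n)) ->
  beta (\prod_(n < l | P n) b n) != 0 /\ iso_mod beta (\prod_(n < l | P n) b n).
Proof.
move=> b0 ib; apply: (big_rec (fun x => beta x != 0 /\ iso_mod beta x)) => [|n x _ [x0 ix]].
  by split; [rewrite rmorph1 oner_neq0|apply: iso_mod1].
by split; [rewrite rmorphM mulf_neq0|apply: iso_modM].
Qed.

Lemma induces_basis_twisted l (b : 'I_l -> B) (m : 'I_l -> nat) (S : 'I_l -> set B) :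
  (forall n, beta (b n) != 0) -> (forall n, iso_mod beta (b n)) ->
  (forall n, induces_basis phi (b n ^+ m n) (S n)) ->
  induces_basis phi (total_product b m) (twisted_union b m S).
Proof.
move=> b0 ib bS.
(* Induction on the number [n] of factors taken into account: [P n] is the partial product and [T n]
   the part of the union with indices below [n]. *)
pose P (n : nat) : B := \prod_(j < l | (j < n)%N) b j ^+ m j.
pose T (n : nat) := [set y | exists (i : 'I_l) x, [/\ (i < n)%N, S i x & y = P i * x]].
have PT : forall n, (n <= l)%N -> induces_basis phi (P n) (T n).
  elim=> [_|n IHn nl].
    have -> : T 0%N = set0 by rewrite -subset0 => x [j [y []]].
    by rewrite /P big_pred0 //; apply: induces_basis_unit.
  pose i := Ordinal nl.
  have -> : T n.+1 = T n `|` [set P n * x | x in S i].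
    apply/seteqP; split=> x.
      move=> [j [y [+ Sy ->]]]; rewrite ltnS leq_eqVlt => /orP[/eqP jn|jn].
        by right; exists y; rewrite -?jn //; have -> : i = j by apply: val_inj.
      by left; exists j, y.
    move=> [[j [y [jm Sy ->]]]|[y Sy <-]]; last by exists i, y.
    by exists j, y; split=> //; apply: ltnW.
  have -> : P n.+1 = P n * b i ^+ m i.
    rewrite {1}/P (bigD1 i) //= mulrC; congr (_ * _); apply: eq_bigl => j.
    by rewrite ltnS [in RHS]ltn_neqAle andbC.
  have bm0 k : beta (b k ^+ m k) != 0 by rewrite rmorphXn expf_neq0.
  have bmi k : iso_mod beta (b k ^+ m k) by apply: iso_mod_exp.
  have [Pn0 _] := iso_mod_prod (fun j : 'I_l => j < n)%N bm0 bmi.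
  by apply: induces_basisM => //; apply/IHn/ltnW.
have := PT l (leqnn l).
have -> : P l = total_product b m by apply: eq_bigl => j; rewrite ltn_ord.
suff -> : T l = twisted_union b m S by [].
apply/seteqP; split=> x.
  by move=> [j [y [_ ? ?]]]; exists j, y.
by move=> [j [y [? ?]]]; exists j, y; split.
Qed.
End BaseRing.

(** * Sections, stalks and the generic point *)

Section RingedSpace.
Variable X : ringed_space.

Lemma res_id (U : opens X) (h : U `<=` U) (s : sec U) : res h s = s.
Proof. by case: (res_sheaf X) => + _ _ _; apply. Qed.

Lemma res_comp (U V W : opens X) (h1 : V `<=` U) (h2 : W `<=` V) (h3 : W `<=` U)
  (s : sec U) : res h2 (res h1 s) = res h3 s.
Proof. by case: (res_sheaf X) => _ + _ _; apply. Qed.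

Lemma sec_empty (U : opens X) (s t : sec U) : (forall x, ~ U x) -> s = t.
Proof. by case: (res_sheaf X) => _ _ + _ U0; apply=> x /U0. Qed.

Lemma open_unit_locus (U : opens X) (s : sec U) : open [set x | unit_at x s].
Proof.
have -> : [set x | unit_at x s] =
    \bigcup_(V in [set V : opens X | exists h : V `<=` U, invertible (res h s)]) V.
  apply/seteqP; split=> x; first by move=> [V [h [Vx]]]; exists V => //; exists h.
  by move=> [V [h hi] Vx]; exists V, h.
by apply: bigcup_open => V _; apply: opens_open.
Qed.

Lemma unit_at_germ (U : opens X) x (hU : U x) (A : comPzRingType) (st : stalk x A)
  (s : sec U) : unit_at x s -> invertible (germ st hU s).
Proof.
move=> [V [h [hV [b e]]]]; exists (germ st hV b).
by rewrite -(germ_res st h hU hV) -rmorphM e rmorph1.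
Qed.

End RingedSpace.

(* Near [q] the scheme is affine, say with ring [A0].  An element [a] of [A0] that
   vanishes at the generic point is killed by a power of some [t] in [A0] that is
   invertible there; as [t] cannot vanish near [q], the domain property of the
   stalk at [q] gives [a = 0] there. *)
Lemma germ_generic_inj (X : scheme) (q eta : X) (heta : is_generic_point eta)
    (A : idomainType) (stA : stalk q A) (F : fieldType) (stF : stalk eta F)
    (iota : {rmorphism A -> F})
    (hiota : forall (U : opens X) (hUq : U q) (hUeta : U eta) (s : sec U),
       iota (germ stA hUq s) = germ stF hUeta s) :
  injective iota.
Proof.
have gen (U : opens X) : U q -> U eta by move=> Uq; apply: heta; exists q.
apply: raddf_inj => a ia0.
have [U1 [hU1 [s1 es1]]] := germ_surj stA a.
have [U0 [U0q [_ aff2 aff3]]] := scheme_affine q.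
have U0e := gen _ U0q.
have [s [sq sV]] : exists s : sec U0, unit_at q s /\
    (forall y, U0 y -> unit_at y s -> opI U1 U0 y).
  by apply: aff2; [move=> y []|split].
have oW : open (U0 `&` [set y | unit_at y s]).
  by apply: openI; [apply: opens_open|apply: open_unit_locus].
pose W := Opens oW.
have hW : W `<=` U0 by move=> y [].
have hW1 : W `<=` U1 by move=> y [U0y /(sV _ U0y) []].
have Wq : W q by split.
(* The germ [a] comes from a section on [W] only; multiplied by a power of [s], which is a unit at
   [q], it extends to a section [a0] on the affine set [U0]. *)
have [/(_ (res hW1 s1)) [n [a0 ea0]] _] := aff3 s W hW (fun y => iff_refl _).
have ga0 : germ stA U0q a0 = a * germ stA U0q s ^+ n.
  by rewrite -(germ_res stA hW U0q Wq) ea0 rmorphM rmorphXn !(germ_res stA _ _ Wq) -es1.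
have [V [hV [Ve Va0]]] : exists (V : opens X) (h : V `<=` U0), V eta /\ res h a0 = 0.
  by apply: (germ_inj (s0 := stF)); rewrite -(hiota _ U0q U0e) ga0 rmorphM ia0 mul0r.
have [t [te tV]] := aff2 V eta hV Ve.
have oT : open (U0 `&` [set y | unit_at y t]).
  by apply: openI; [apply: opens_open|apply: open_unit_locus].
pose T := Opens oT.
have hT : T `<=` U0 by move=> y [].
have hTV : T `<=` V by move=> y [U0y /(tV _ U0y)].
have [_ /(_ a0) []] := aff3 t T hT (fun y => iff_refl _).
  by rewrite -(res_comp hV hTV) Va0 rmorph0.
move=> n' /(congr1 (germ stA U0q)); rewrite rmorphM rmorphXn rmorph0 ga0.
have invn0 (K : idomainType) (z : K) : invertible z -> z != 0.
  by move=> [b zb]; apply/eqP => z0; move/eqP: zb; rewrite z0 mul0r eq_sym oner_eq0.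
have s0 : germ stA U0q s != 0 by apply/invn0/unit_at_germ.
have t0 : germ stA U0q t != 0.
  apply/eqP => gt0; have := invn0 _ _ (unit_at_germ U0e stF te).
  by rewrite -(hiota _ U0q U0e) gt0 rmorph0 eqxx.
by move/eqP; rewrite !mulf_eq0 !expf_eq0 (negbTE s0) (negbTE t0) !andbF /= orbF => /eqP.
Qed.

(** * Local equations and the sheaves O and O(D) inside the function field *)

Section Divisor.
Variables (C D : scheme) (i : morphism D C).

Lemma ideal_sec_res (U V : opens C) (h : V `<=` U) (s : sec U) :
  ideal_sec i s -> ideal_sec i (res h s).
Proof.
move=> si W hW; have hW' : W `<=` i @^-1` U by move=> y /hW /h.
by rewrite (pull_res hW' hW h (fun _ => id)) si rmorph0.
Qed.

Lemma ideal_sec_off (U : opens C) (s : sec U) :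
  (forall y, ~ U (i y)) -> ideal_sec i s.
Proof. by move=> Ui V hV; apply: sec_empty => y /hV /Ui. Qed.

Lemma local_equation_res (U V : opens C) (h : V `<=` U) (d : sec U) :
  is_local_equation i d -> is_local_equation i (res h d).
Proof. by move=> dd W hW; rewrite (res_comp h hW (subset_trans hW h)). Qed.

Lemma local_equation_ideal (U : opens C) (d : sec U) :
  is_local_equation i d -> forall s : sec U, ideal_sec i s <-> divides d s.
Proof. by move=> /(_ U (fun _ => id)) [+ _]; rewrite res_id. Qed.

Lemma local_equation_in_ideal (U : opens C) (d : sec U) :
  is_local_equation i d -> ideal_sec i d.
Proof. by move=> dd; apply/(local_equation_ideal dd); exists 1; rewrite mul1r. Qed.

Variables (eta : C) (heta : is_generic_point eta) (F : fieldType) (stF : stalk eta F).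

(** If [d] restricted to 0 near [eta], its regularity there would force 1 = 0 in the sections, hence
    in the field [F]. *)
Lemma local_equation_generic_neq0 (U : opens C) (hU : U eta) (d : sec U) :
  is_local_equation i d -> germ stF hU d != 0.
Proof.
move=> dd; apply/eqP => /germ_inj [V [h [Ve d0]]].
have [_ /(_ 1)] := dd V h; rewrite d0 mulr0 => /(_ erefl) /(congr1 (germ stF Ve)).
by rewrite rmorph1 rmorph0 => /eqP; rewrite oner_eq0.
Qed.

Lemma sheaf_O_sub (U V : opens C) f : V `<=` U -> sheaf_O stF U f -> sheaf_O stF V f.
Proof.
move=> VU Uf x Vx; have [W [We [a [Wx WU ->]]]] := Uf x (VU _ Vx).
have WVe : opI W V eta by apply: heta; exists x.
have h : opI W V `<=` W by move=> y [].
by exists (opI W V), WVe, (res h a); split=> [//|y []//|]; rewrite (germ_res stF h We).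
Qed.

Lemma sheaf_OD_sub (U V : opens C) f :
  V `<=` U -> sheaf_OD i stF U f -> sheaf_OD i stF V f.
Proof.
move=> VU Uf x Vx; have [W [We [d [a [Wx WU dd df]]]]] := Uf x (VU _ Vx).
have WVe : opI W V eta by apply: heta; exists x.
have h : opI W V `<=` W by move=> y [].
exists (opI W V), WVe, (res h d), (res h a).
by split=> [//|y []//||]; rewrite ?(germ_res stF h We) //; apply: local_equation_res.
Qed.

(** Off the divisor the ideal sheaf is the unit ideal, so a local equation is invertible there. *)
Lemma sheaf_OD_off (U : opens C) f :
  (forall y, ~ U (i y)) -> sheaf_OD i stF U f -> sheaf_O stF U f.
Proof.
move=> Ui Uf x Ux; have [W [We [d [a [Wx WU dd df]]]]] := Uf x Ux.
have [c ec] : divides d 1.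
  by apply/(local_equation_ideal dd)/ideal_sec_off => y /WU /Ui.
exists W, We, (c * a); split=> //.
by rewrite rmorphM -df mulrA -rmorphM -ec rmorph1 mul1r.
Qed.

Hypothesis hD : is_effective_divisor i.

Lemma sheaf_OD0 (U : opens C) : sheaf_OD i stF U 0.
Proof.
move=> x Ux; have [V [d [Vx dd]]] := hD.2 x.
have e : opI V U eta by apply: heta; exists x.
have h : opI V U `<=` V by move=> y [].
exists (opI V U), e, (res h d), 0; split=> [//|y []//||].
  exact: local_equation_res.
by rewrite mulr0 rmorph0.
Qed.

Lemma sheaf_O0 (U : opens C) : sheaf_O stF U 0.
Proof.
move=> x Ux; have e : U eta by apply: heta; exists x.
by exists U, e, 0; split=> //; rewrite rmorph0.
Qed.

(** On the overlap both local equations generate the same ideal, so [d] is a multiple of [d'] and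
    serves as a common denominator. *)
Lemma sheaf_ODD (U : opens C) f g :
  sheaf_OD i stF U f -> sheaf_OD i stF U g -> sheaf_OD i stF U (f + g).
Proof.
move=> Uf Ug x Ux.
have [V [Ve [d [a [Vx VU dd df]]]]] := Uf x Ux.
have [W [We [d' [a' [Wx WU dd' dg]]]]] := Ug x Ux.
have e : opI V W eta by apply: heta; exists x.
have hV : opI V W `<=` V by move=> y [].
have hW : opI V W `<=` W by move=> y [].
have [c ec] : divides (res hW d') (res hV d).
  apply/(local_equation_ideal (local_equation_res hW dd')).
  by apply/local_equation_in_ideal/local_equation_res.
exists (opI V W), e, (res hV d), (res hV a + c * res hW a').
split=> [//|y [/VU]//||]; first exact: local_equation_res.
rewrite mulrDr [in X in _ + X]ec rmorphD !rmorphM -mulrA.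
by rewrite !(germ_res stF hV Ve e) !(germ_res stF hW We e) df dg.
Qed.

Lemma sheaf_ODZ (U : opens C) (b : @sec C opT) f :
  sheaf_OD i stF U f -> sheaf_OD i stF U (germ stF (U := opT) Logic.I b * f).
Proof.
move=> Uf x /Uf [V [Ve [d [a [Vx VU dd df]]]]].
have h : V `<=` opT by [].
exists V, Ve, d, (res h b * a); split=> [//|//|//|].
by rewrite mulrCA df rmorphM (germ_res stF h Logic.I).
Qed.

End Divisor.

(** * Global sections of O(D)/O as germs at [q] *)

Section QuotientSheaf.
Variables (R : comNzRingType) (C : scheme_over R) (D : scheme) (i : morphism D C).
Hypothesis hD : is_effective_divisor i.
Variables (q : C) (hDq : range i `<=` local_spec q).
Variables (eta : C) (heta : is_generic_point eta) (F : fieldType) (stF : stalk eta F).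
Variables (Q : module_sheaf R C) (proj : forall U : opens C, F -> msec Q U).
Let phiF : {rmorphism R -> F} := germ stF (U := opT) Logic.I \o str C.
Let E := sheaf_OD i stF.
Let E0 := sheaf_O stF.
Hypothesis hQ : is_quotient_sheaf (ring_act phiF) E E0 proj.

Let proj_lin (U : opens C) r f g : E U f -> E U g ->
  proj U (ring_act phiF r f + g) = r *: proj U f + proj U g.
Proof. by case: hQ => + _ _ _; apply. Qed.

Let proj_res (U V : opens C) (h : V `<=` U) f :
  E U f -> mres Q h (proj U f) = proj V f.
Proof. by case: hQ => _ + _ _; apply. Qed.

Let proj_eq0 (U : opens C) f : E U f -> (proj U f = 0 <-> E0 U f).
Proof. by case: hQ => _ _ + _; apply. Qed.

Let proj_surj (U : opens C) (s : msec Q U) x : U x ->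
  exists (V : opens C) (h : V `<=` U) (f : F),
    [/\ V x, E V f & mres Q h s = proj V f].
Proof. by case: hQ => _ _ _; apply. Qed.

Lemma mres_comp (U V W : opens C) (h1 : V `<=` U) (h2 : W `<=` V) (h3 : W `<=` U)
  (s : msec Q U) : mres Q h2 (mres Q h1 s) = mres Q h3 s.
Proof. by case: (mres_sheaf Q) => _ + _ _; apply. Qed.

Let nbhd_divisor (U : opens C) y : U q -> U (i y).
Proof. by move=> Uq; apply: (hDq _ Uq); exists y. Qed.

Let open_off : open (~` range i).
Proof.
have [[_ cl _] _] := hD; rewrite openC -[range i]/(i @` setT).
exact/cl/closedT.
Qed.
Let off : opens C := Opens open_off.

(** Separation and gluing of global sections of [Q] both use this cover by two open sets. *)
Let cover_off (U : opens C) x : U q -> U x \/ off x.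
Proof.
move=> Uq; have [[y _ <-]|xi] := pselect (range i x); last by right.
by left; apply: nbhd_divisor.
Qed.

Let proj_off (V : opens C) f : V `<=` off -> E V f -> proj V f = 0.
Proof.
move=> Voff Vf; apply/(proj_eq0 Vf)/(sheaf_OD_off _ Vf) => y /Voff; apply.
by exists y.
Qed.

(** [Q] is zero on [off], so a section that vanishes on [U] vanishes locally everywhere, and
    separation applies. *)
Lemma global_section_eq0 (U : opens C) (h : U `<=` opT) (s : msec Q opT) :
  U q -> mres Q h s = 0 -> s = 0.
Proof.
move=> Uq Us; case: (mres_sheaf Q) => _ _ sep _; apply: sep => x _.
have [Ux|xoff] := cover_off x Uq; first by exists U, h; rewrite Us raddf0.
have [V [hV [f [Vx Vf sf]]]] := proj_surj s (x := x) Logic.I.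
have hW : opI V off `<=` opT by [].
have hWV : opI V off `<=` V by move=> y [].
exists (opI V off), hW; split=> //.
rewrite -(mres_comp hV hWV hW) sf proj_res // raddf0.
by apply: proj_off => [y []//|]; apply: sheaf_OD_sub Vf.
Qed.

Local Notation induced := (is_induced_at E proj q).

(** The class of [f] on [U] is glued with 0 on [off]; they agree on overlaps by [proj_off]. *)
Lemma induced_exists (U : opens C) f : U q -> E U f -> exists s, induced f s.
Proof.
move=> Uq Uf.
pose V (b : bool) := if b then U else off.
pose s (b : bool) : msec Q (V b) :=
  if b return msec Q (V b) then proj U f else 0.
(* Both alternatives are equations in [msec Q W], a type free of [b], so compatibility becomes a
   check of four cases. *)
have sP b (W : opens C) (h : W `<=` V b) : E W f /\ mres Q h (s b) = proj W f \/
    W `<=` off /\ mres Q h (s b) = 0.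
  by case: b h => h; [left; split; [apply: sheaf_OD_sub Uf|apply: proj_res]|
    right; rewrite raddf0].
case: (mres_sheaf Q) => _ _ _ /(_ opT bool V (fun _ _ _ => Logic.I) s).
case=> [x _|b c W hb hc|t tP].
- by have [Ux|xoff] := cover_off x Uq; [exists true|exists false].
- case: (sP b W hb) => -[W1 ->]; case: (sP c W hc) => -[W2 ->] //.
  + exact: proj_off.
  + by rewrite proj_off.
- by exists t, U, (fun _ _ => Logic.I); split=> //; apply: (tP true).
Qed.

Lemma induced_lin r f g s t :
  induced f s -> induced g t -> induced (ring_act phiF r f + g) (r *: s + t).
Proof.
move=> [U [hU [Uq Uf sf]]] [V [hV [Vq Vg tg]]].
have UVU : opI U V `<=` U by move=> x [].
have UVV : opI U V `<=` V by move=> x [].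
have Wf := sheaf_OD_sub heta UVU Uf; have Wg := sheaf_OD_sub heta UVV Vg.
exists (opI U V), (fun _ _ => Logic.I); split=> //.
  by apply: (sheaf_ODD heta) => //; apply: sheaf_ODZ.
rewrite linearP proj_lin //.
by rewrite -(mres_comp hU UVU) sf -(mres_comp hV UVV) tg !proj_res.
Qed.

Lemma induced0 : induced 0 0.
Proof.
have E00 : E opT 0 by apply: sheaf_OD0.
exists opT, (fun _ _ => Logic.I); split=> //; rewrite raddf0; apply/esym.
by apply/(proj_eq0 E00)/sheaf_O0.
Qed.

Lemma induced_sum (I : eqType) (r : seq I) (c : I -> R) (f : I -> F)
    (s : I -> msec Q opT) : (forall x, x \in r -> induced (f x) (s x)) ->
  induced (\sum_(x <- r) ring_act phiF (c x) (f x)) (\sum_(x <- r) c x *: s x).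
Proof.
elim: r => [|x r IHr] fs; first by rewrite !big_nil; apply: induced0.
rewrite !big_cons; apply: induced_lin; first exact/fs/mem_head.
by apply: IHr => y yr; apply: fs; rewrite in_cons yr orbT.
Qed.

(** A global section is determined near [q], and there the kernel of [proj] consists of the regular
    functions. *)
Lemma induced_eq0 f s : induced f s ->
  s = 0 <-> exists2 U : opens C, U q & E0 U f.
Proof.
move=> [U [hU [Uq Uf sf]]]; split=> [s0|[V Vq Vf]].
  by exists U => //; apply/(proj_eq0 Uf); rewrite -sf s0 raddf0.
have UVU : opI U V `<=` U by move=> x [].
apply: (@global_section_eq0 (opI U V) (fun _ _ => Logic.I)) => //.
rewrite -(mres_comp hU UVU) sf proj_res //.
by apply/(proj_eq0 (sheaf_OD_sub heta UVU Uf)); apply: sheaf_O_sub Vf => // x [].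
Qed.

Lemma induced_unique f s t : induced f s -> induced f t -> s = t.
Proof.
move=> fs ft; apply/eqP; rewrite -subr_eq0 addrC -scaleN1r; apply/eqP.
have /induced_eq0 -> := induced_lin (-1) ft fs.
exists opT => //; rewrite /ring_act rmorphN rmorph1 mulN1r addNr.
exact: sheaf_O0.
Qed.

(** * Comparison of the germs at [q] with A / P A *)

Variables (A : idomainType) (stA : stalk q A) (iota : {rmorphism A -> F}).
Hypothesis hiota : forall (U : opens C) (hUq : U q) (hUeta : U eta) (s : sec U),
  iota (germ stA hUq s) = germ stF hUeta s.
Let phiA : {rmorphism R -> A} := germ stA (U := opT) Logic.I \o str C.

Variable P : A.
Hypothesis hP : ideal_stalk i stA = divides P.

Let iota_inj : injective iota.
Proof. exact: germ_generic_inj hiota. Qed.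

Let iota_phi r : iota (phiA r) = phiF r.
Proof. exact: hiota. Qed.

(** Together with [in_E] below, this computes the stalks at [q] of O and O(D) inside [F]: they are
    the images of A and of P^-1 A. *)
Let in_E0 f : (exists2 U : opens C, U q & E0 U f) <-> exists a, f = iota a.
Proof.
split=> [[U Uq /(_ q Uq) [V [Ve [a [Vq _ ->]]]]]|[a ->]].
  by exists (germ stA Vq a); rewrite (hiota _ Ve).
have [U [Uq [s <-]]] := germ_surj stA a.
have Ue : U eta by apply: heta; exists q.
by exists U => // x Ux; exists U, Ue, s; split=> //; apply: hiota.
Qed.

(** [P] is itself the germ of a section of the ideal sheaf, and on a common neighbourhood [d]
    divides that section. *)
Let local_equation_germ (U : opens C) (Uq : U q) (d : sec U) :
  is_local_equation i d -> divides P (germ stA Uq d) /\ divides (germ stA Uq d) P.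
Proof.
move=> dd; split.
  by rewrite -hP; exists U, Uq, d; split=> //; apply: local_equation_in_ideal.
have [V [Vq [s [si <-]]]] : ideal_stalk i stA P by rewrite hP; exists 1; rewrite mul1r.
have UVU : opI U V `<=` U by move=> x [].
have UVV : opI U V `<=` V by move=> x [].
have UVq : opI U V q by split.
have [c ec] : divides (res UVU d) (res UVV s).
  apply/(local_equation_ideal (local_equation_res UVU dd)).
  exact: ideal_sec_res.
exists (germ stA UVq c).
by rewrite -(germ_res stA UVU Uq UVq) -(germ_res stA UVV Vq UVq) ec rmorphM.
Qed.

Lemma divisor_germ_neq0 : P != 0.
Proof.
have [U [d [Uq dd]]] := hD.2 q.
have Ue : U eta by apply: heta; exists q.
have [[u eu] _] := local_equation_germ Uq dd.
apply/eqP => P0; have := local_equation_generic_neq0 stF Ue dd.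
by rewrite -(hiota Uq) eu P0 mulr0 rmorph0 eqxx.
Qed.

Let iP0 : iota P != 0.
Proof. by rewrite raddf_eq0 ?divisor_germ_neq0. Qed.

Let in_E f : (exists2 U : opens C, U q & E U f) <-> exists a, f = (iota P)^-1 * iota a.
Proof.
split=> [[V Vq /(_ q Vq) [W [We [d [a [Wq _ dd df]]]]]]|[a ->]].
  have [_ [w ew]] := local_equation_germ Wq dd.
  exists (w * germ stA Wq a); apply: (mulfI iP0); rewrite mulVKf //.
  by rewrite {1}ew !rmorphM -mulrA !(hiota _ We) df.
have [U [d [Uq dd]]] := hD.2 q.
have [[u eu] _] := local_equation_germ Uq dd.
(* As the germ of [d] is [u * P], the fraction a / P equals (u a) / d; [b] represents this
   numerator. *)
have [V [Vq [b eb]]] := germ_surj stA (u * a).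
have UVU : opI U V `<=` U by move=> x [].
have UVV : opI U V `<=` V by move=> x [].
have UVe : opI U V eta by apply: heta; exists q.
have UVq : opI U V q by split.
exists (opI U V) => // x UVx.
exists (opI U V), UVe, (res UVU d), (res UVV b).
split=> [//|//||]; first exact: local_equation_res.
rewrite -!(hiota UVq) (germ_res stA UVU Uq) (germ_res stA UVV Vq) eb eu !rmorphM.
by rewrite mulrA mulfK // mulrC.
Qed.

(** The basis is transported along B/(b) = A/PA = P^-1 A / A = H^0(C, Q), where [x] goes to the
    section induced by [fr x]. *)
Lemma induces_basis_H0_of_quotient (B : comPzRingType) (beta : {rmorphism B -> A})
    (phi : {rmorphism R -> B}) (b : B) (S : set B) :
  (forall r, beta (phi r) = phiA r) -> beta b = P -> iso_mod beta b ->
  induces_basis phi b S ->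
  induces_basis_H0 E proj q [set (iota P)^-1 * iota (beta x) | x in S].
Proof.
move=> beta_phi bP [injb surjb] [indS spanS].
pose fr x := (iota P)^-1 * iota (beta x).
have fr_sum (I : eqType) (r : seq I) (c : I -> R) (x : I -> B) :
    \sum_(j <- r) ring_act phiF (c j) (fr (x j)) =
    fr (\sum_(j <- r) ring_act phi (c j) (x j)).
  rewrite /fr !rmorph_sum mulr_sumr; apply: eq_bigr => j _.
  by rewrite /ring_act !rmorphM beta_phi iota_phi mulrCA.
(* Only the values of [h] at fractions [fr x] matter; 0 is a default. *)
have /choice [h hP'] : forall f, exists s, (exists x, f = fr x) -> induced f s.
  move=> f; have [[x ->]|nf] := pselect (exists x, f = fr x); last by exists 0.
  have [|U Uq Uf] := (in_E (fr x)).2; first by exists (beta x).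
  by have [s ?] := induced_exists Uq Uf; exists s.
have hS f : [set fr x | x in S] f -> induced f (h f).
  by move=> [x _ <-]; apply: hP'; exists x.
exists h; split=> [f Sf s|].
  by split=> [/induced_unique/(_ (hS _ Sf))|->]; last exact: hS.
split=> [r c ur rS hr0|s].
  (* [g] picks a preimage in [S] of each fraction in [r], so that a relation among sections can be
     read in [B]. *)
  have /choice [g gP] : forall f, exists x, f \in r -> S x /\ fr x = f.
    move=> f; have [/rS [x Sx fx]|_] := boolP (f \in r); last by exists 0.
    by exists x.
  have gK : {in r, cancel g fr} by move=> f /gP [].
  (* A vanishing combination of sections means that the sum of fractions lies in [A]. Multiplied by
     [P] it becomes divisible by [P], and [injb] carries this divisibility to [B]. *)
  have /induced_eq0 [+ _] := induced_sum c (fun f fr => hS f (rS f fr)).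
  move=> /(_ hr0) /in_E0 [a ea].
  move=> f fr'; rewrite -(gK f fr').
  apply: (indS [seq g f | f <- r] (c \o fr)).
  - by rewrite map_inj_in_uniq //; apply: can_in_inj gK.
  - by move=> _ /mapP[f' /gP[? _] ->].
  - apply: injb; exists a; rewrite bP mulrC; apply: iota_inj.
    rewrite rmorphM -ea; apply: (canRL (mulVKf iP0)).
    rewrite -/(fr _) big_map -(fr_sum _ _ (c \o fr \o g)) !big_seq.
    by apply: eq_bigr => f' f'r; rewrite /= gK.
  - exact: map_f.
have [V [hV [f [Vq Vf sf]]]] := proj_surj s (x := q) Logic.I.
have sf' : induced f s by exists V, hV.
have [a ea] : exists a, f = (iota P)^-1 * iota a by apply/in_E; exists V.
(* Replacing [a] by [beta x] modulo [P], then [x] by a combination of [S] modulo [b], leaves the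
   error [(e + beta e') * P], which is regular after division by [P]. *)
have [x [e ee]] := surjb a.
have [t [c [_ tS [e' ee']]]] := spanS x.
have LS u : u \in [seq (c j, fr j) | j <- t] -> [set fr x | x in S] u.2.
  by move=> /mapP[j /tS ? ->]; exists j.
(* The basis of sections is indexed by fractions, so terms with equal fractions are merged. *)
have [r [c' [ur rS er]]] := combination_collect (sc := fun r s => r *: s)
  (fun w => scale0r w) (fun w r r' => scalerDl w r r') h LS.
exists r, c'; split=> //; rewrite -er big_map /=.
have ht : induced (\sum_(j <- t) ring_act phiF (c j) (fr j))
                  (\sum_(j <- t) c j *: h (fr j)).
  by apply: induced_sum => j /tS ?; apply: hS; exists j.
have /induced_eq0 [_ eq0] := induced_lin (-1) ht sf'.
rewrite addrC -scaleN1r; apply/eq0/in_E0.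
exists (e + beta e'); apply: (mulfI iP0).
rewrite fr_sum ea /fr /ring_act rmorphN rmorph1 mulN1r mulrDr mulrN !mulVKf //.
rewrite addrC -rmorphB -rmorphM; congr (iota _).
set z := \sum_(j <- t) _ in ee' *.
rewrite -(subrK (beta x) a) ee -addrA -rmorphB ee' rmorphM bP.
by rewrite -mulrDl mulrC.
Qed.

End QuotientSheaf.

Theorem proposition12p12
    (R : comNzRingType) (hR : is_padic_valuation_ring R)
    (k : fieldType) (kappa : {rmorphism R -> k}) (hk : is_residue_field kappa)
    (g : nat) (C : scheme_over R) (hC : is_proper_smooth_curve C g)
    (D : scheme_over R) (i : morphism D C) (hi : is_over_id i)
    (hD : is_effective_divisor i) (hDfin : is_finite_over D)
    (d : nat) (hd : has_degree_at D kappa d) (hdg : (2 * g <= d + 1)%N)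
    (q : C) (hqcl : closed [set q]) (hqk : fibre_points kappa q)
    (hq : forall Z : set D, is_irreducible_component Z ->
       (i @` Z) `&` fibre_points kappa = [set q])
    (A : idomainType) (stA : stalk q A) (hA : is_UFD A)
    (eta : C) (heta : is_generic_point eta)
    (F : fieldType) (stF : stalk eta F)
    (iota : {rmorphism A -> F})
    (hiota : forall (U : opens C) (hUq : U q) (hUeta : U eta) (s : sec U),
       iota (germ stA hUq s) = germ stF hUeta s)
    (l : nat) (pi : 'I_l -> A) (m : 'I_l -> nat)
    (hpi : forall n, is_prime_elt (pi n)) (hpi_inj : injective pi)
    (hm : forall n, (1 <= m n)%N)
    (hDq : range i `<=` local_spec q)
    (hDpi : ideal_stalk i stA = divides (total_product pi m))
    (Q : module_sheaf R C) (proj : forall U : opens C, F -> msec Q U)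
    (hQ : is_quotient_sheaf
       (ring_act (germ stF (U := opT) Logic.I \o str C))
       (sheaf_OD i stF) (sheaf_O stF) proj) :
  let phiA : {rmorphism R -> A} := germ stA (U := opT) Logic.I \o str C in
  (forall Sigma' : 'I_l -> set A,
     (forall n, induces_basis phiA (pi n) (Sigma' n)) ->
     let Sigma_ n := power_union (pi n) (m n) (Sigma' n) in
     let Sigma := twisted_union pi m Sigma_ in
     [/\ forall n, induces_basis phiA (pi n ^+ m n) (Sigma_ n),
         induces_basis phiA (total_product pi m) Sigma &
         induces_basis_H0 (sheaf_OD i stF) proj q
           [set (iota (total_product pi m))^-1 * iota x | x in Sigma]])
  /\
  (forall (S : scheme_over R) (j : morphism S C),
     is_over_id j -> @is_affine S opT -> is_subspace_with_stalks j ->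
     let B := @sec S opT in
     forall y : S, j y = q ->
     forall beta : {rmorphism B -> A}, is_natural_to_stalk j y stA beta ->
     forall p : 'I_l -> B, (forall n, beta (p n) = pi n) ->
     (forall n, iso_mod beta (p n)) ->
     forall Sigma' : 'I_l -> set B,
     (forall n, induces_basis (str S) (p n) (Sigma' n)) ->
     let Sigma_ n := power_union (p n) (m n) (Sigma' n) in
     let Sigma := twisted_union p m Sigma_ in
     [/\ forall n, induces_basis (str S) (p n ^+ m n) (Sigma_ n),
         induces_basis (str S) (total_product p m) Sigma &
         induces_basis_H0 (sheaf_OD i stF) proj q
           [set (iota (total_product pi m))^-1 * iota (beta x) | x in Sigma]]).

Proof.
move=> phiA.
have pi0 n : pi n != 0 by case: (hpi n) => /eqP.
(* Used twice: for [A] with the identity, and for [B] with [beta]. *)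
have H0 := induces_basis_H0_of_quotient hD hDq heta hQ hiota hDpi.
split=> [Sigma' hS Sigma_ Sigma|].
  have iso (b : A) : iso_mod (idfun : {rmorphism A -> A}) b.
    by split=> // a; exists a; exists 0; rewrite subrr mul0r.
  have bS n : induces_basis phiA (pi n ^+ m n) (Sigma_ n).
    exact: (induces_basis_power (beta := idfun) _ (pi0 n) (iso _) (hS n)).
  have bT : induces_basis phiA (total_product pi m) Sigma.
    exact: (induces_basis_twisted (beta := idfun) pi0 (fun n => iso _) bS).
  by split=> //; apply: (H0 A idfun phiA (total_product pi m)).
move=> S j jR _ _ B y jy beta hbeta p hp isop Sigma' hS Sigma_ Sigma.
have p0 n : beta (p n) != 0 by rewrite hp.
have bS n : induces_basis (str S) (p n ^+ m n) (Sigma_ n).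
  exact: (induces_basis_power _ (p0 n) (isop n) (hS n)).
have bT : induces_basis (str S) (total_product p m) Sigma.
  exact: (induces_basis_twisted p0 isop bS).
split=> //; apply: (H0 B beta (str S) (total_product p m)) => // [r||].
(* Naturality is applied to the global section [str C r], whose pull-back along [j] is [str S r]
   because [j] lies over [R]. *)
- apply: (hbeta _ opT Logic.I _ opT (fun _ _ => Logic.I) (fun _ => id)) => //.
  by rewrite res_id; apply: jR.
- by rewrite rmorph_prod; apply: eq_bigr => n _; rewrite rmorphXn /= hp.
- apply: (iso_mod_prod xpredT _ _).2 => n; first by rewrite rmorphXn expf_neq0.
  exact: iso_mod_exp.
Qed.
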